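(* Let $G$ be a $2$-edge-connected decomposable cubic graph on $n$ vertices. Then $\mathrm{mms}(G)\ge n/2-2$.
   Context: All graphs are finite and simple; a cubic graph is one in which every vertex has degree $3$. A matching $M$ of $G$ is separating if $G-M$ has more connected components than $G$. A graph is decomposable if it has a separating matching (equivalently, a matching cut: a matching that equals the set of edges between $X$ and $V(G)\setminus X$ for some nonempty proper $X\subseteq V(G)$). $\mathrm{mms}(G)$ denotes the maximum size of a separating matching of $G$ (and $\mathrm{mms}(G)=0$ if none exists). *)

(* Defs.v *)
From mathcomp Require Import all_boot all_order all_algebra.

Set Implicit Arguments.
Unset Strict Implicit.
Unset Printing Implicit Defensive.

Record sgraph := SGraph {
  vertex :> finType;
  adj : rel vertex;
  adj_sym : symmetric adj;
  adj_irrefl : irreflexive adj }.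

Definition neighbours (G : sgraph) (x : G) : {set G} := [set y | adj x y].

Definition cubic (G : sgraph) : Prop := forall x : G, #|neighbours x| = 3.

Definition edges (G : sgraph) : {set {set G}} :=
  [set [set p.1; p.2] | p : G * G & adj p.1 p.2].

(* Only edges are removed: all vertices are kept. *)
Definition del_adj (G : sgraph) (F : {set {set G}}) : rel G :=
  [rel x y | adj x y && ([set x; y] \notin F)].

Lemma del_adj_sym (G : sgraph) (F : {set {set G}}) : symmetric (del_adj F).
Proof. by move=> x y; rewrite /del_adj /= adj_sym setUC. Qed.

Lemma del_adj_irrefl (G : sgraph) (F : {set {set G}}) :
  irreflexive (del_adj F).
Proof. by move=> x; rewrite /del_adj /= adj_irrefl. Qed.

Definition del_edges (G : sgraph) (F : {set {set G}}) : sgraph :=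
  SGraph (@del_adj_sym G F) (@del_adj_irrefl G F).

Definition components (G : sgraph) : nat := n_comp (@adj G) [set: G].

Definition connected (G : sgraph) : Prop :=
  forall x y : G, connect (@adj G) x y.

Definition edge_connected (k : nat) (G : sgraph) : Prop :=
  1 < #|G| /\
  forall F : {set {set G}},
    F \subset edges G -> #|F| < k -> connected (del_edges F).

(* Pairwise disjoint edges; the empty set of edges is a matching. *)
Definition matching (G : sgraph) (M : {set {set G}}) : bool :=
  (M \subset edges G) && trivIset M.

Definition separating_matching (G : sgraph) (M : {set {set G}}) : bool :=
  matching M && (components G < components (del_edges M)).

Definition decomposable (G : sgraph) : Prop :=
  exists M : {set {set G}}, separating_matching M.

(* The maximum over an empty range is 0. *)
Definition mms (G : sgraph) : nat :=
  \max_(M : {set {set G}} | separating_matching M) #|M|.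

(* Main.v *)
Require Import Defs.
From mathcomp Require Import all_boot all_order all_algebra zify lra.

(* By Petersen's theorem (obtained from the Tutte-Berge formula) [G] has a
   perfect matching, seen as a fixed-point-free involution [f]. If the 2-factor
   [G - f] is disconnected, [f] itself is a separating matching of size [n/2].
   Otherwise [G - f] is a Hamiltonian cycle with successor map [s].

   If two chords do not cross, take a maximal arc [A] of the cycle whose two end
   vertices have their chords inside [A] and whose complement contains a chord.
   By maximality the end vertices of the complementary arc have their chords
   inside the complement. Replacing the chords of these four vertices by the two
   cycle edges that leave [A] turns [f] into a matching of size at least
   [n/2 - 2] that contains the edge cut of [A].

   If all chords cross pairwise then [f] commutes with [s] and [G] is a Moebius
   ladder, which has a separating perfect matching as soon as [n >= 8]; for
   [n <= 6] the bound only says that a separating matching is nonempty. *)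

Set Implicit Arguments.
Unset Strict Implicit.
Unset Printing Implicit Defensive.

(** The points moved by [f] come in pairs [{x, f x}], which the induction strips from [A] one at a
    time. *)
Lemma odd_card_involution (T : finType) (f : T -> T) (A : {set T}) :
  involutive f -> {in A, forall x, f x \in A} ->
  odd #|A| = odd #|[set x in A | f x == x]|.
Proof.
move=> fK; have [k] := ubnP #|A|; elim: k A => // k IH A ltAk fA.
have [A0|[x]] := set_0Vmem [set x in A | f x != x].
  congr odd; congr #|pred_of_set _|; apply/setP => x; rewrite inE.
  have /setP/(_ x) := A0; rewrite !inE.
  by case: (x \in A) => //= /negbFE ->.
rewrite inE => /andP[xA fx].
have fxA : f x \in A :\ x by rewrite !inE fx fA.
set B := A :\ x :\ f x.
have cA : #|A| = #|B|.+2 by rewrite (cardsD1 x A) xA (cardsD1 (f x) (A :\ x)) fxA.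
rewrite cA /= negbK IH; last first.
- move=> y; rewrite !inE => /and3P[yfx yx yA].
  by rewrite fA // andbT (inj_eq (inv_inj fK)) yx /= -(inj_eq (inv_inj fK)) fK.
- by move: ltAk; rewrite cA => /ltnW.
congr odd; congr #|pred_of_set _|; apply/setP => y; rewrite !inE.
have [->|yx] := eqVneq y x; first by rewrite (negbTE fx) !andbF.
have [->|_] := eqVneq y (f x); last by [].
by rewrite fK [x == _]eq_sym (negbTE fx) !andbF.
Qed.

(** * Gallai's lemma and the Tutte-Berge formula *)

Section Deficiency.
Variable G : sgraph.
Implicit Types (W U C : {set G}) (f g : {ffun G -> G}).

(** A matching inside [W] is encoded as an involution that swaps partners and fixes uncovered
    vertices. Since [f x] is moved whenever [x] is, both ends of an edge lie in [W]. *)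
Definition matching_on W f :=
  [forall x, f (f x) == x] && [forall x, (f x != x) ==> adj x (f x) && (x \in W)].

Definition missed W f := [set x in W | f x == x].

Definition maximum_on W f :=
  matching_on W f &&
  [forall g, matching_on W g ==> (#|missed W f| <= #|missed W g|)].

Lemma matching_onP W f :
  reflect (involutive f /\ forall x, f x != x -> adj x (f x) /\ x \in W)
          (matching_on W f).
Proof.
apply: (iffP andP) => [[/forallP fK /forallP fW]|[fK fW]]; split.
- by move=> x; apply/eqP.
- by move=> x fx; have /implyP/(_ fx)/andP := fW x.
- by apply/forallP => x; rewrite fK.
- by apply/forallP => x; apply/implyP => /fW[-> ->].
Qed.

Lemma maximum_onP W f :
  reflect (matching_on W f /\
           forall g, matching_on W g -> #|missed W f| <= #|missed W g|)
          (maximum_on W f).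
Proof.
apply: (iffP andP) => [[fM /forallP h]|[fM h]]; split=> //.
  by move=> g gM; have /implyP := h g; apply.
by apply/forallP => g; apply/implyP; apply: h.
Qed.

Lemma odd_missed W f : matching_on W f -> odd #|missed W f| = odd #|W|.
Proof.
move=> /matching_onP[fK fW]; rewrite [RHS](odd_card_involution fK) // => x xW.
have [-> //|fx] := eqVneq (f x) x.
by have [] := fW (f x); rewrite // fK eq_sym.
Qed.

Lemma maximum_exists W : exists f, maximum_on W f.
Proof.
pose f0 : {ffun G -> G} := [ffun x => x].
have f0M : matching_on W f0.
  by apply/matching_onP; split=> [x|x]; rewrite !ffunE // eqxx.
have [f fM fmin] := @arg_minnP _ f0 (matching_on W) (fun f => #|missed W f|) f0M.
by exists f; apply/maximum_onP; split=> // g /fmin.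
Qed.

(** The exchange at an uncovered vertex [x]: the edge [xy] enters and the former partner of [y], if
    any, is freed. *)
Definition rematch f (x y : G) : {ffun G -> G} :=
  [ffun w => if w == x then y else if w == y then x
             else if w == f y then w else f w].

Lemma rematch_matching W f x y :
  matching_on W f -> f x = x -> adj x y -> x \in W -> y \in W ->
  matching_on W (rematch f x y).
Proof.
move=> /matching_onP[fK fW] fx xy xW yW.
have yx : y != x by apply: contraTneq xy => ->; rewrite adj_irrefl.
have fI := inj_eq (inv_inj fK).
apply/matching_onP; split=> w; rewrite !ffunE.
  have [->|wx] := eqVneq w x; first by rewrite (negbTE yx) eqxx.
  have [->|wy] := eqVneq w y; first by rewrite eqxx.
  have [wE|wfy] := eqVneq w (f y).
    by rewrite (negbTE wx) (negbTE wy) -wE eqxx.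
  by rewrite -{1}fx fI (negbTE wx) -{1}(fK y) !fI (negbTE wfy) (negbTE wy) fK.
have [->|wx] := eqVneq w x; first by rewrite xy xW.
have [->|wy] := eqVneq w y; first by rewrite adj_sym xy yW.
by have [->|wfy] := eqVneq w (f y); [rewrite eqxx|exact: fW].
Qed.

Lemma maximum_adj_covered W f x y :
  maximum_on W f -> f x = x -> adj x y -> x \in W -> y \in W -> f y != y.
Proof.
move=> /maximum_onP[fM fmax] fx xy xW yW; apply/eqP => fy.
have := fmax _ (rematch_matching fM fx xy xW yW); rewrite leqNgt => /negP[].
have yx : y != x by apply: contraTneq xy => ->; rewrite adj_irrefl.
apply: proper_card; apply/properP; split.
  apply/subsetP => w; rewrite !inE ffunE => /andP[-> /=].
  have [->|wx] := eqVneq w x; first by rewrite fx.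
  have [->|wy] := eqVneq w y; first by rewrite fy.
  by rewrite fy (negbTE wy).
by exists x; rewrite !inE ?fx ?xW ?ffunE ?eqxx.
Qed.

(** [x] becomes covered and only [f y] can become uncovered in its place, so the deficiency does not
    grow. *)
Lemma rematch_maximum W f x y :
  maximum_on W f -> f x = x -> adj x y -> x \in W -> y \in W ->
  maximum_on W (rematch f x y).
Proof.
move=> fmx fx xy xW yW; have fy := maximum_adj_covered fmx fx xy xW yW.
have /maximum_onP[fM fmax] := fmx; apply/maximum_onP; split.
  exact: rematch_matching.
move=> g /fmax; apply: leq_trans.
have /matching_onP[fK fW] := fM.
have xm : x \in missed W f by rewrite inE xW fx eqxx.
apply: (@leq_trans #|f y |: missed W f :\ x|); last first.
  by rewrite (cardsD1 x (missed W f)) xm cardsU1 leq_add2r leq_b1.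
apply/subset_leq_card/subsetP => w; rewrite !inE ffunE.
have [->|wx] := eqVneq w x.
  by rewrite (_ : (y == x) = false) ?andbF //; apply: contraTF xy => /eqP->; rewrite adj_irrefl.
have [->|wy] := eqVneq w y; last by have [->|] := eqVneq w (f y).
by rewrite (_ : (x == y) = false) ?andbF //; apply: contraTF xy => /eqP->; rewrite adj_irrefl.
Qed.

Definition missable W := [forall x in W, exists f, maximum_on W f && (f x == x)].

(** Gallai's relation: an equivalence on [W] once [W] is missable, and adjacent vertices of [W] are
    always related. *)
Definition inseparable W u v :=
  (u == v) || ~~ [exists f, [&& maximum_on W f, f u == u & f v == v]].

(* Gallai's lemma: take a maximum matching [f] missing [u], [v] and a maximum
   matching [g] missing [t] that agrees with [f] as much as possible; an
   exchange at a vertex covered by [f] only increases the agreement. *)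
Lemma inseparable_trans W u t v : missable W -> u \in W -> t \in W -> v \in W ->
  inseparable W u t -> inseparable W t v -> inseparable W u v.
Proof.
move=> mW uW tW vW ut tv; apply/norP => -[uv /negPn/existsP[f /and3P[fmx fu fv]]].
have covers w h : w \in [set u; v] -> maximum_on W h -> h t == t -> h w != w.
  move=> wuv hmx ht; have wt : w != t.
    move: wuv; rewrite !inE => /orP[]/eqP->.
      apply/eqP => utE; case/orP: tv => [/eqP tE|/existsP[]].
        by rewrite utE tE eqxx in uv.
      by exists f; rewrite fmx fv -utE fu.
    apply/eqP => vtE; case/orP: ut => [/eqP tE|/existsP[]].
      by rewrite vtE tE eqxx in uv.
    by exists f; rewrite fmx fu -vtE fv.
  move: wuv wt; rewrite !inE => /orP[]/eqP-> wt; apply/negP => hw.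
    case/orP: ut => [|/existsP[]]; first by rewrite (negbTE wt).
    by exists h; rewrite hmx hw ht.
  case/orP: tv => [|/existsP[]]; first by rewrite eq_sym (negbTE wt).
  by exists h; rewrite hmx hw ht.
have /forall_inP/(_ t tW)/existsP[g0 g0P] := mW.
have [g /andP[gmx gt] gbest] := @arg_maxnP _ g0
  (fun g => maximum_on W g && (g t == t)) (fun g => #|[set x | f x == g x]|) g0P.
have cardE : #|missed W f| = #|missed W g|.
  have /maximum_onP[fM fl] := fmx; have /maximum_onP[gM gl] := gmx.
  by apply/eqP; rewrite eqn_leq fl // gl.
(* [f] and [g] miss equally many vertices, and [u], [v] are missed by [f] only; so at least two
   vertices are missed by [g] only, and one of them is not [t]. *)
have [x xgf xt] : exists2 x, x \in missed W g :\: missed W f & x != t.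
  have : 1 < #|missed W g :\: missed W f|.
    have : #|missed W g :\: missed W f| = #|missed W f :\: missed W g|.
      by rewrite !cardsD setIC cardE.
    move=> ->; apply: (@leq_trans #|[set u; v]|); first by rewrite cards2 uv.
    apply/subset_leq_card/subsetP => w wuv.
    have := covers w g wuv gmx gt; rewrite !inE => /negbTE ->.
    by move: wuv; rewrite !inE andbF => /orP[]/eqP->; rewrite ?fu ?fv ?uW ?vW.
  rewrite (cardsD1 t) => h.
  have /card_gt0P[x] : 0 < #|(missed W g :\: missed W f) :\ t|.
    by move: h; case: (t \in _) => //= /ltnW.
  by rewrite in_setD1 => /andP[? ?]; exists x.
move: xgf; rewrite !inE => /andP[xf /andP[xW /eqP gx]].
rewrite xW /= in xf.
have /maximum_onP[/matching_onP[fK fW] _] := fmx.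
have /maximum_onP[/matching_onP[gK gW] _] := gmx.
have [xy _] := fW x xf; set y := f x in xy xf.
have fy : f y = x by rewrite /y fK.
have yW : y \in W by have [] := fW y; rewrite // fy eq_sym.
have gy := maximum_adj_covered gmx gx xy xW yW.
have g'mx := rematch_maximum gmx gx xy xW yW.
have : maximum_on W (rematch g x y) && (rematch g x y t == t).
  rewrite g'mx ffunE [t == x]eq_sym (negbTE xt) /=.
  have ty : t != y by apply: contraNneq gy => <-.
  rewrite (negbTE ty); by case: ifP => // _; apply: eqxx.
move=> /gbest; rewrite /= leqNgt => /negP[]; apply: proper_card; apply/properP; split.
  apply/subsetP => w; rewrite !inE ffunE => /eqP fgw.
  have [->|wx] := eqVneq w x; first by [].
  have [->|wy] := eqVneq w y; first by rewrite fy.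
  have [wE|_] := eqVneq w (g y); last by rewrite fgw.
  by move: fgw; rewrite wE gK => /(canRL fK); rewrite fy -wE => /eqP; rewrite (negbTE wx).
by exists x; rewrite inE ?ffunE ?eqxx //= gx.
Qed.

(** Induction on [#|W|]. A vertex covered by every maximum matching is deleted from [W] and joins
    the barrier [U]. If there is none, Gallai's lemma applies and inseparability classes serve as
    the odd sets, with [U] empty. *)
Lemma tutte_berge W : exists f U (P : {set {set G}}),
  [/\ matching_on W f, trivIset P,
      {in P, forall C, odd #|C| /\
         forall x y, x \in C -> y \in W -> adj x y -> y \in C :|: U} &
      #|missed W f| + #|U| <= #|P|].
Proof.
have [k] := ubnP #|W|; elim: k W => // k IH W ltWk.
have [mW|/forall_inPn[v vW vN]] := boolP (missable W); last first.
  have [|f [U [P [fM tP PU le]]]] := IH (W :\ v).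
    by move: ltWk; rewrite (cardsD1 v W) vW.
  have [g gmx] := maximum_exists W.
  have /maximum_onP[gM gmin] := gmx.
  have fM' : matching_on W f.
    have /matching_onP[fK fW] := fM; apply/matching_onP; split=> // x fx.
    by have [? ] := fW x fx; rewrite !inE => /andP[_ ?].
  have fv : f v == v.
    have /matching_onP[_ fW] := fM; apply/negPn/negP => /fW[_].
    by rewrite !inE eqxx.
  have missE : #|missed W f| = #|missed (W :\ v) f|.+1.
    rewrite (cardsD1 v) inE vW fv; congr _.+1; apply: eq_card => x.
    by rewrite !inE andbA.
  exists g, (v |: U), P; split=> //.
    move=> C /PU[oC nC]; split=> // x y xC yW xy.
    have [->|yv] := eqVneq y v; first by rewrite !inE eqxx !orbT.
    have := nC x y xC; rewrite !inE yv yW => /(_ isT xy) /orP[->//|->].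
    by rewrite !orbT.
  have lt : #|missed W g| < #|missed W f|.
    rewrite ltnNge; apply: contra vN => le'; apply/existsP; exists f.
    rewrite fv andbT; apply/maximum_onP; split=> // h /gmin; exact: leq_trans.
  (* [f] and [g] are both matchings inside [W], so they miss numbers of the same parity: a strict
     gap is a gap of at least two. *)
  have : #|missed W g| < #|missed (W :\ v) f|.
    move: lt; rewrite missE ltnS leq_eqVlt => /orP[/eqP E|//].
    have := odd_missed fM'; rewrite -(odd_missed gM) missE E /=.
    by case: (odd _).
  move=> lt2; apply: leq_trans le; rewrite cardsU1.
  by rewrite addnA leq_add2r; case: (v \notin U); rewrite ?addn1 // addn0 ltnW.
have [f fmx] := maximum_exists W; have /maximum_onP[fM _] := fmx.
have /matching_onP[fK fW] := fM.
pose cl u := [set v in W | inseparable W u v].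
have isym u v : inseparable W u v = inseparable W v u.
  rewrite /inseparable eq_sym; congr (_ || ~~ _).
  by apply: eq_existsb => h; rewrite [_ && (h u == u)]andbC.
have adj_insep x y : x \in W -> y \in W -> adj x y -> inseparable W x y.
  move=> xW yW xy; apply/orP; right; apply/negP => /existsP[h /and3P[hmx /eqP hx hy]].
  by have := maximum_adj_covered hmx hx xy xW yW; rewrite hy.
have clE u v : u \in W -> v \in W -> inseparable W u v -> cl u = cl v.
  move=> uW vW uv; apply/setP => w; rewrite !inE; have [wW|//] := boolP (w \in W).
  apply/idP/idP; first by apply: inseparable_trans; rewrite // isym.
  exact: inseparable_trans.
have cl_missed u v : u \in missed W f -> v \in missed W f -> v \in cl u -> u = v.
  rewrite !inE => /andP[_ fu] /andP[_ fv] /andP[_ /orP[/eqP//|/existsP[]]].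
  by exists f; rewrite fmx fu.
have subW u : u \in missed W f -> u \in W by rewrite inE => /andP[].
have selfcl u : u \in W -> u \in cl u by move=> uW; rewrite inE uW /inseparable eqxx.
(* The class of a missed vertex contains no other missed vertex, and [f] matches the rest of the
   class within itself; hence its size is odd. *)
exists f, set0, (cl @: missed W f); split=> //.
- apply/trivIsetP => A B /imsetP[u uM ->] /imsetP[v vM ->] ne.
  rewrite -setI_eq0; apply/eqP/setP => w; rewrite in_setI [in RHS]inE.
  apply/negP => /andP[wu wv].
  have wW : w \in W by move: wu; rewrite inE => /andP[].
  move: wu wv ne; rewrite !inE wW /= => wu wv.
  by rewrite (clE u w (subW u uM)) ?(clE v w (subW v vM)) ?eqxx.
- move=> C /imsetP[u uM ->]; have uW := subW u uM; split; last first.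
    move=> x y; rewrite !inE orbF => /andP[xW ux] yW xy; rewrite yW.
    exact: inseparable_trans (adj_insep x y xW yW xy).
  rewrite (odd_card_involution fK).
    rewrite (_ : [set _ in _ | _] = [set u]) ?cards1 //.
    apply/setP => w; rewrite in_set in_set1; apply/andP/eqP => [[wu fw]|->].
      by apply/esym/cl_missed => //; rewrite inE fw andbT; move: wu; rewrite inE => /andP[].
    by split; [apply: selfcl|move: uM; rewrite inE => /andP[]].
  move=> x xu; have [->//|fx] := eqVneq (f x) x.
  move: xu; rewrite !inE => /andP[xW ux].
  have fxW : f x \in W by have [] := fW (f x); rewrite // fK eq_sym.
  rewrite fxW; apply: inseparable_trans ux _ => //; apply: adj_insep => //.
  by case: (fW x fx).
rewrite cards0 addn0 card_in_imset // => u v uM vM E.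
by apply: cl_missed => //; rewrite E selfcl ?subW.
Qed.

End Deficiency.

Lemma connect_uncrossed (T : finType) (e : rel T) (A : {set T}) x y :
  symmetric e -> (forall u v, u \in A -> v \notin A -> ~~ e u v) ->
  connect e x y -> x \in A -> y \in A.
Proof.
move=> sym_e eA xy; rewrite (@closed_connect _ e (mem A) _ x y) //.
apply: intro_closed => [|u v uv uA]; first exact: sym_connect_sym.
by apply: contraLR uv => /(eA u v uA).
Qed.

(** * Edge counting and Petersen's theorem *)

Section Petersen.
Variable G : sgraph.
Implicit Types C D : {set G}.

(** Ordered pairs are counted, so [between C C] counts every edge inside [C] twice. *)
Definition between C D := \sum_(x in C) \sum_(y in D) (adj x y : nat).

Lemma betweenE C D :
  between C D = #|[set p in setX C D | adj p.1 p.2]|.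
Proof.
rewrite /between -sum1_card pair_big_dep /= [RHS]big_mkcond [LHS]big_mkcond.
by apply: eq_bigr => p _; rewrite !inE; case: (_ && _); case: adj.
Qed.

Lemma between_sym C D : between C D = between D C.
Proof.
rewrite /between exchange_big; apply: eq_bigr => x _; apply: eq_bigr => y _.
by rewrite adj_sym.
Qed.

Lemma between_setT C : cubic G -> between C setT = #|C| * 3.
Proof.
move=> G3; rewrite -sum_nat_const; apply: eq_bigr => x _.
rewrite -(G3 x) -sum1_card [RHS]big_mkcond /=.
by apply: eq_big => [y|y _]; rewrite !inE //; case: adj.
Qed.

Lemma between_split C D : between C setT = between C D + between C (~: D).
Proof.
rewrite /between -big_split; apply: eq_bigr => x _ /=.
rewrite (bigID (mem D)) /=; congr (_ + _); apply: eq_bigl => y; rewrite !inE //.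
Qed.

Lemma between_same_even C : ~~ odd (between C C).
Proof.
rewrite betweenE (@odd_card_involution _ (fun p => (p.2, p.1))).
- rewrite (_ : [set _ in _ | _] = set0) ?cards0 //; apply/setP => -[x y].
  rewrite !inE /=; apply/negP => /andP[/andP[_ xy] /eqP[yx _]].
  by rewrite yx adj_irrefl in xy.
- by case.
- by case=> x y; rewrite !inE /= adj_sym [_ && (x \in C)]andbC.
Qed.

(** The degree sum [3 * #|C|] is odd and edges inside [C] contribute an even amount, so the cut is
    odd; a cut of size one would be a bridge. *)
Lemma odd_cut_ge3 C : cubic G -> edge_connected 2 G -> odd #|C| ->
  2 < between C (~: C).
Proof.
move=> G3 [_ G2] oC.
have o : odd (between C (~: C)).
  have := between_setT C G3; rewrite (between_split _ C) => /(congr1 odd).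
  by rewrite oddD oddM oC (negbTE (between_same_even C)).
rewrite ltnNge; apply/negP => le2.
have {o le2}/eqP : between C (~: C) = 1 by case: between o le2 => [|[|[]]].
rewrite betweenE => /cards1P[[a b] E].
have : (a, b) \in [set (a, b)] by rewrite inE.
rewrite -E !inE /= => /andP[/andP[aC bC] ab].
have cut (u v : G) : u \in C -> v \notin C -> ~~ del_adj [set [set a; b]] u v.
  move=> uC vC; rewrite /del_adj /= negb_and negbK.
  have [uv|//] := boolP (adj u v).
  have : (u, v) \in [set p in setX C (~: C) | adj p.1 p.2] by rewrite !inE uC vC.
  by rewrite E !inE => /eqP[-> ->]; rewrite eqxx.
move/negP: bC; apply; apply: (connect_uncrossed _ cut) aC; first exact: del_adj_sym.
apply: G2; last by rewrite cards1.
by rewrite sub1set; apply/imsetP; exists (a, b); rewrite ?inE.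
Qed.

(** Each odd set sends at least three edges to the barrier [U], which receives at most [3 * #|U|].
    Hence [#|P| <= #|U|], and the deficiency in [tutte_berge] is zero. *)
Theorem petersen : cubic G -> edge_connected 2 G ->
  exists f : G -> G, involutive f /\ forall x, adj x (f x).
Proof.
move=> G3 G2; have [f [U [P [fM tP PU le]]]] := tutte_berge [set: G].
have : \sum_(C in P) 3 <= #|U| * 3.
  apply: (@leq_trans (\sum_(C in P) between C U)).
    apply: leq_sum => C /PU[oC nC]; apply: leq_trans (odd_cut_ge3 G3 G2 oC) _.
    apply: leq_sum => x xC; rewrite [X in X <= _]big_mkcond [X in _ <= X]big_mkcond.
    apply: leq_sum => y _; rewrite inE.
    have [yC|yC] := boolP (y \in C) => //=.
    case E: (adj x y); last by case: ifP.
    by have := nC x y xC (in_setT _) E; rewrite inE (negbTE yC) /= => ->.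
  rewrite -(big_trivIset _ tP) /= -between_setT // between_sym.
  rewrite [X in X <= _]big_mkcond /= /between.
  rewrite [X in _ <= X](eq_bigl xpredT); last by move=> x; rewrite inE.
  by apply: leq_sum => x _; case: ifP.
rewrite sum_nat_const leq_pmul2r // => le2.
have m0 : missed [set: G] f = set0.
  by apply/eqP; rewrite -cards_eq0 -leqn0 -(leq_add2r #|U|) (leq_trans le).
have /matching_onP[fK fW] := fM; exists f; split=> // x.
have [fx|/fW[]//] := eqVneq (f x) x.
by have /setP/(_ x) := m0; rewrite !inE fx eqxx.
Qed.

End Petersen.

(** * Component counts and separating matchings *)

Section Components.
Variable G : sgraph.

Lemma edge_connectedW k : edge_connected k.+1 G -> connected G.
Proof.
move=> [_ G2] x y; have := G2 set0 (sub0set _) _ x y; rewrite cards0 => /(_ isT).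
by rewrite (@eq_connect _ _ (@adj G)) // => u v; rewrite /= /del_adj /= inE andbT.
Qed.

Lemma connected_components : connected G -> components G <= 1.
Proof.
move=> cG; apply/card_le1_eqP => x y; rewrite !inE !andbT => /eqP <- /eqP <-.
by apply/(fingraph.rootP (sym_connect_sym (@adj_sym G))).
Qed.

Lemma disconnected_components (x y : G) :
  ~~ connect (@adj G) x y -> 1 < components G.
Proof.
move=> nxy; have cs : connect_sym (@adj G) by apply/sym_connect_sym/adj_sym.
apply/card_gt1P; exists (fingraph.root (@adj G) x), (fingraph.root (@adj G) y).
split; rewrite ?inE ?andbT; try exact: roots_root.
by rewrite root_connect.
Qed.

End Components.

Section Separating.
Variable G : sgraph.

(** The 2-element orbits of [g] form a matching that contains every edge leaving [A], so deleting it
    separates [a] from [b]; the fixed points of [g] are the vertices it leaves uncovered. *)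
Lemma leq_mms (g : G -> G) (A : {set G}) (a b : G) :
  connected G -> involutive g -> (forall x, g x != x -> adj x (g x)) ->
  a \in A -> b \notin A ->
  (forall x y, x \in A -> y \notin A -> adj x y -> y = g x) ->
  #|G| <= 2 * mms G + #|[set x | g x == x]|.
Proof.
move=> cG gK gadj aA bA gA.
pose D := [set x | g x != x]; pose M := [set [set x; g x] | x in D].
have blockE B z : B \in M -> z \in B -> B = [set z; g z].
  by move=> /imsetP[x xD ->]; rewrite !inE => /orP[]/eqP-> //; rewrite gK setUC.
have tM : trivIset M.
  apply/trivIsetP => B C BM CM; apply: contraNT.
  rewrite -setI_eq0 => /set0Pn[z]; rewrite inE => /andP[zB zC].
  by rewrite (blockE B z) // (blockE C z).
have pM : partition M D.
  apply/and3P; split=> //.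
    rewrite eqEsubset; apply/andP; split; last first.
      apply/subsetP => x xD; apply/bigcupP; exists [set x; g x]; last by rewrite !inE eqxx.
      exact: imset_f.
    apply/bigcupsP => B /imsetP[x xD ->]; apply/subsetP => z.
    by move: xD; rewrite !inE => gx /orP[]/eqP->; rewrite // gK eq_sym.
  by apply/imsetP => -[x _ /setP/(_ x)]; rewrite !inE eqxx.
have cD : #|D| = #|M| * 2.
  apply: card_uniform_partition pM => B /imsetP[x]; rewrite inE => gx ->.
  by rewrite cards2 eq_sym gx.
have sM : separating_matching M.
  apply/andP; split.
    rewrite /matching tM andbT; apply/subsetP => B /imsetP[x]; rewrite inE => gx ->.
    by apply/imsetP; exists (x, g x); rewrite // inE /= gadj.
  apply: leq_ltn_trans (connected_components cG) _.
  apply: (@disconnected_components (del_edges M) a b).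
  apply: contra bA => ab; apply: connect_uncrossed ab aA; first exact: adj_sym.
  move=> /= u v uA vA; rewrite /= /del_adj /= negb_and negbK.
  have [uv|//] := boolP (adj u v); have vE := gA u v uA vA uv.
  apply/imsetP; exists u; rewrite ?vE // inE -vE.
  by apply: contraTneq uv => ->; rewrite adj_irrefl.
have le : #|M| <= mms G by rewrite /mms; apply: leq_bigmax_cond.
rewrite -(cardsC [set x | g x == x]) addnC leq_add2r mulnC.
have -> : ~: [set x | g x == x] = D by apply/setP => x; rewrite !inE.
by rewrite cD leq_mul2r le orbT.
Qed.

Lemma mms_gt0 : decomposable G -> 0 < mms G.
Proof.
move=> [M sM]; apply: (@leq_trans #|M|); last by rewrite /mms; apply: leq_bigmax_cond.
rewrite card_gt0; apply: contraTneq sM => ->; rewrite /separating_matching negb_and.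
apply/orP; right; rewrite -leqNgt /components.
suff /eq_n_comp -> : connect (@adj (del_edges (set0 : {set {set G}}))) =2 connect (@adj G) by [].
by apply: eq_connect => x y; rewrite /= /del_adj /= inE andbT.
Qed.

End Separating.

(** * Hamiltonian cycles of connected 2-regular graphs *)

Section TwoRegular.
Variables (T : finType) (e : rel T).
Hypothesis e_sym : symmetric e.
Hypothesis e_irr : irreflexive e.
Hypothesis e2 : forall x, #|[set y | e x y]| = 2.

Lemma maximal_path (x0 : T) :
  exists x p, [/\ path e x p, uniq (x :: p) & forall y, e x y -> y \in p].
Proof.
(* [k] bounds how often the path can still be extended at its head, since a simple path has at most
   [#|T|] vertices. *)
suff H k x p : path e x p -> uniq (x :: p) -> #|T| <= size p + k ->
    exists x p, [/\ path e x p, uniq (x :: p) & forall y, e x y -> y \in p].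
  by apply: (H #|T| x0 [::]).
elim: k x p => [|k IH] x p xp up le.
  by have := max_card (mem (x :: p)); rewrite (card_uniqP up) /= ltnNge -[size p]addn0 le.
have [/forallP h|/forallPn[y]] := boolP [forall y, e x y ==> (y \in p)].
  by exists x, p; split=> // y; apply/implyP.
rewrite negb_imply => /andP[xy yp].
apply: (IH y (x :: p)); last by rewrite /= addSnnS.
  by rewrite /= e_sym xy.
rewrite cons_uniq up inE negb_or yp !andbT.
by apply: contraTneq xy => ->; rewrite e_irr.
Qed.

Lemma two_neighbours x y z w : y != z -> e x y -> e x z -> e x w -> w \in [:: y; z].
Proof.
move=> yz xy xz xw; apply/negPn/negP; rewrite !inE negb_or => /andP[wy wz].
have : #|[set y; z; w]| <= #|[set y | e x y]|.
  apply/subset_leq_card/subsetP => u; rewrite !inE.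
  by case/orP=> [/orP[]|] /eqP->.
rewrite e2 -setUA cardsU1 cards2 !inE negb_or yz [y == w]eq_sym wy.
by rewrite [z == w]eq_sym wz.
Qed.

(** Both neighbours of the head [x] of a maximal path lie on the path. The one that is not the
    second vertex must be the last: otherwise it would have [x], its predecessor and its successor
    as three neighbours. *)
Lemma two_regular_cycle (x0 : T) :
  exists c, [/\ cycle e c, uniq c & 2 < size c].
Proof.
have [x [p [xp up px]]] := maximal_path x0.
have /eqP/cards2P[u [v [uv xE]]] := e2 x.
have xu : e x u by have /setP/(_ u) := xE; rewrite !inE eqxx.
have xv : e x v by have /setP/(_ v) := xE; rewrite !inE eqxx orbT.
case: p => [|x1 q] in xp up px *; first by have := px u xu.
have [w wx1 xw] : exists2 w, w != x1 & e x w.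
  by have [E|] := eqVneq u x1; [exists v; rewrite // -E eq_sym|exists u].
have := px w xw; rewrite inE (negbTE wx1) /= => wq.
case/splitPr: wq => q1 q2 in xp up px *.
move: xp => /=; rewrite cat_path /= => /and3P[xx1 x1q1 /andP[zw wq2]].
case: q2 => [|y q3] in up px wq2 *; last first.
  move: wq2 => /= /andP[wy _].
  have zin : last x1 q1 \in x1 :: q1 by apply: mem_last.
  move: up; rewrite -cat_cons -cat_cons cat_uniq.
  rewrite [uniq (x :: _)]cons_uniq => /and3P[/andP[xN uq1] dis _].
  have zx : last x1 q1 != x by apply: contraNneq xN => <-.
  have notin t : t \in [:: w, y & q3] -> t \notin x :: x1 :: q1.
    by move=> th; apply: contra dis => ?; apply/hasP; exists t.
  have yN : y \notin x :: x1 :: q1 by apply: notin; rewrite !inE eqxx orbT.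
  have := @two_neighbours w _ _ y zx; rewrite e_sym zw e_sym xw wy => /(_ isT isT isT).
  rewrite !inE => /orP[]/eqP E; move: yN; rewrite E !inE ?eqxx //.
  by move: zin; rewrite inE => ->; rewrite orbT.
exists [:: x, x1 & q1 ++ [:: w]]; split=> //=; last by rewrite size_cat /= addn1.
by rewrite xx1 rcons_cat cat_path /= x1q1 zw e_sym xw.
Qed.

Lemma two_regular_hamiltonian (x0 : T) : (forall x y, connect e x y) ->
  exists s t : T -> T, [/\ cancel s t, cancel t s, forall x y, fconnect s x y &
    forall x y, e x y = (y \in [:: s x; t x])].
Proof.
move=> conn; have [c [ce cu cs]] := two_regular_cycle x0.
have st : cancel (next c) (prev c) by apply: prev_next.
have ts : cancel (prev c) (next c) by apply: next_prev.
have ntp x : x \in c -> next c x != prev c x.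
  move=> xc; apply/eqP => E.
  (* If [next] and [prev] agreed at [x], the orbit of [x] would have at most two elements, against
     [2 < size c]. *)
  have := @order_le_cycle _ (next c) [:: x; next c x] _ x.
  rewrite /= eqxx E ts eqxx inE eqxx => /(_ isT isT).
  by rewrite (order_cycle (cycle_next cu)) //; lia.
have ep x : x \in c -> e x (prev c x) by move=> xc; rewrite e_sym; apply: prev_cycle.
have eE x y : x \in c -> e x y = (y \in [:: next c x; prev c x]).
  move=> xc; apply/idP/idP; last first.
    by rewrite !inE => /orP[]/eqP->; [apply: next_cycle|apply: ep].
  by apply: two_neighbours; [apply: ntp|apply: next_cycle|apply: ep].
have [x1 x1c] : exists x1, x1 \in c.
  by case: c cs {ce cu st ts ntp ep eE} => // x1 c _; exists x1; rewrite inE eqxx.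
have all_c y : y \in c.
  have := @connect_uncrossed _ e [set z in c] x1 y e_sym; rewrite !inE; apply=> //.
  move=> u v; rewrite !inE => uc; apply: contra; rewrite eE // !inE.
  by case/orP=> /eqP->; rewrite ?mem_next ?mem_prev.
exists (next c), (prev c); split=> // x y; last exact: eE.
by rewrite (fconnect_cycle (cycle_next cu)).
Qed.

End TwoRegular.

(** * Arcs of a cycle with chords *)

Section Arcs.
Variables (T : finType) (f s t : T -> T).
Hypothesis fN : forall x, f x != x.
Hypotheses (sK : cancel s t) (tK : cancel t s) (sN : forall x, s x != x).
Hypothesis s_full :
  forall A : {set T}, (exists a, a \in A) -> {in A, forall x, s x \in A} -> A = setT.

(** The stretch of the cycle from [a] to [b] in direction [s], with the chords at both ends inside.
    Exchanging [s] and [t] reverses the orientation, so each lemma on one end also serves the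
    other. *)
Definition arc (A : {set T}) a b :=
  [/\ [/\ a != b, a \in A & b \in A], f a \in A /\ f b \in A,
      s b \notin A /\ t a \notin A,
      {in A, forall x, x != b -> s x \in A} &
      {in A, forall x, x != a -> t x \in A}].

(** If the cycle re-entered [A] after the single vertex [s b], that vertex alone would be the
    complement, which contains both [z] and [f z]. *)
Lemma arc_gap A a b z : arc A a b -> z \notin A -> f z \notin A -> s (s b) \notin A.
Proof.
move=> [[ab aA bA] _ [sbA taA] sA tA] zA fzA; apply/negP => ssbA.
have ssb : s (s b) = a.
  by apply/eqP; apply: contraNT sbA => /(tA _ ssbA); rewrite sK.
have full : s b |: A = setT.
  apply: s_full; first by exists a; rewrite !inE aA orbT.
  move=> x; rewrite !inE => /orP[/eqP->|xA]; first by rewrite ssb aA orbT.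
  by have [->|/(sA x xA)->] := eqVneq x b; rewrite ?eqxx ?orbT.
have := fN z; have := in_setT z; have := in_setT (f z); rewrite -full !inE.
by rewrite (negbTE zA) (negbTE fzA) !orbF => /eqP-> /eqP->; rewrite eqxx.
Qed.

Lemma arc_extend A a b z : arc A a b -> z \notin A -> f z \notin A ->
  f (s b) \in A -> arc (s b |: A) a (s b).
Proof.
move=> arcA zA fzA fsbA; have gap := arc_gap arcA zA fzA.
case: arcA => [[ab aA bA] [faA fbA] [sbA taA] sA tA].
split; [split|split|split| |]; rewrite ?inE ?eqxx ?aA ?faA ?fsbA ?orbT //.
- by apply: contraNneq sbA => <-.
- by rewrite negb_or sN.
- by rewrite negb_or taA andbT; apply: contraNneq gap => <-; rewrite tK.
- move=> x; rewrite !inE => /orP[->//|xA _].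
  by have [->|/(sA x xA)->] := eqVneq x b; rewrite ?eqxx ?orbT.
- move=> x; rewrite !inE => /orP[/eqP->|xA xa]; first by rewrite sK bA orbT.
  by rewrite tA ?orbT.
Qed.

End Arcs.

Lemma arc_sym (T : finType) (f s t : T -> T) A a b : arc f s t A a b -> arc f t s A b a.
Proof.
by move=> [[? ? ?] [? ?] [? ?] ? ?]; split=> //; split=> //; rewrite eq_sym.
Qed.

(** * Chords of a Hamiltonian cycle in a cubic graph *)

Section Hamiltonian.
Variables (G : sgraph) (f s t : G -> G).
Hypothesis cG : connected G.
Hypotheses (fK : involutive f) (f_adj : forall x, adj x (f x)).
Hypotheses (sK : cancel s t) (tK : cancel t s).
Hypothesis s_conn : forall x y, fconnect s x y.
Hypothesis nbr : forall x y : G, adj x y = (y \in [:: f x; s x; t x]).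
Hypothesis fs : forall x, f x != s x.

Let n := #|G|.

Lemma adj_neq (x y : G) : adj x y -> y != x.
Proof. by apply: contraTneq => ->; rewrite adj_irrefl. Qed.

Lemma f_neq x : f x != x. Proof. exact: adj_neq. Qed.
Lemma s_adj x : adj x (s x). Proof. by rewrite nbr !inE eqxx orbT. Qed.
Lemma t_adj x : adj x (t x). Proof. by rewrite nbr !inE eqxx !orbT. Qed.
Lemma s_neq x : s x != x. Proof. exact/adj_neq/s_adj. Qed.
Lemma t_neq x : t x != x. Proof. exact/adj_neq/t_adj. Qed.

Lemma s_closed_full (A : {set G}) :
  (exists a, a \in A) -> {in A, forall x, s x \in A} -> A = setT.
Proof.
move=> [a aA] sA; apply/setP => y; rewrite inE -(iter_findex (s_conn a y)).
by elim: (findex _ _ _) => //= i IH; apply: sA.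
Qed.

Lemma t_closed_full (A : {set G}) :
  (exists a, a \in A) -> {in A, forall x, t x \in A} -> A = setT.
Proof.
move=> [a aA] tA; apply/eqP; rewrite -subTset.
apply/subsetP => y _; apply/negPn/negP => yA; have : ~: A = setT.
  apply: s_closed_full; first by exists y; rewrite inE.
  by move=> x; rewrite !inE; apply: contra => /tA; rewrite sK.
by move=> /setP/(_ a); rewrite !inE aA.
Qed.

Lemma arc_cut A a b : arc f s t A a b -> f (s b) \notin A -> f (t a) \notin A ->
  n <= 2 * mms G + 4.
Proof.
move=> arcA; set p := s b; set q := t a => fpA fqA.
have gap : s p \notin A.
  by apply: (arc_gap f_neq sK s_closed_full arcA _ fpA); case: arcA => _ _ [].
case: arcA => [[ab aA bA] [faA fbA] [pA qA] sA tA].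
have neqA u v : u \in A -> v \notin A -> (u == v = false) * (v == u = false).
  by move=> uA vA; rewrite [v == u]eq_sym; split; apply: contraNF vA => /eqP<-.
have pq : (p == q = false) * (q == p = false).
  by rewrite [q == p]eq_sym; split; apply: contraNF gap => /eqP->; rewrite /q tK.
have abE : (a == b = false) * (b == a = false) by rewrite [b == a]eq_sym (negbTE ab).
pose K := [:: b; p; a; q].
(* A chord with an end in [K] is dropped; its other end, if outside [K], becomes a fixed point. *)
pose g x := if x == b then p else if x == p then b else if x == a then q
  else if x == q then a else if f x \in K then x else f x.
have gE x : x \notin K -> g x = if f x \in K then x else f x.
  move=> xK; have : [&& x != b, x != p, x != a & x != q].
    by move: xK; rewrite !inE !negb_or.
  by rewrite /g => /and4P[/negbTE-> /negbTE-> /negbTE-> /negbTE->].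
have gb : g b = p by rewrite /g eqxx.
have gp : g p = b by rewrite /g (neqA b p) // eqxx.
have ga : g a = q by rewrite /g abE (neqA a p) // eqxx.
have gq : g q = a by rewrite /g (neqA b q) // pq (neqA a q) // eqxx.
have gK : involutive g.
  move=> x; have [|xK] := boolP (x \in K).
    by rewrite !inE => /or4P[]/eqP->; rewrite ?gb ?gp ?ga ?gq.
  rewrite (gE x xK); have [fxK|fxK] := boolP (f x \in K); first by rewrite gE // fxK.
  by rewrite gE // fK (negbTE xK).
have g_adj x : g x != x -> adj x (g x).
  have [|xK] := boolP (x \in K).
    rewrite !inE => /or4P[]/eqP-> _; rewrite ?gb ?gp ?ga ?gq; [|rewrite adj_sym| |rewrite adj_sym].
    - exact: s_adj.
    - exact: s_adj.
    - exact: t_adj.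
    - exact: t_adj.
  by rewrite gE //; case: ifP => //; rewrite eqxx.
(* A chord leaving [A] has no end in [K], because the chords at [a], [b] stay inside [A] and those
   at [p], [q] outside; so [g] keeps it. *)
apply: leq_trans (leq_mms cG gK g_adj aA pA _) _.
  move=> x y xA yA; rewrite nbr !inE => /or3P[]/eqP E.
  - rewrite E gE; last first.
      rewrite !inE !negb_or (neqA x p) // (neqA x q) //= andbT.
      by apply/andP; split; apply: contraNneq yA => xE; rewrite E xE.
    rewrite ifF //; apply/negbTE; rewrite !inE -E !negb_or.
    rewrite (neqA b y) // (neqA a y) //=.
    by apply/andP; split; apply: contraTneq xA => yE; rewrite -(fK x) -E yE.
  - have xb : x = b by apply/eqP; apply: contraNT yA => /(sA x xA); rewrite E.
    by rewrite E xb gb.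
  - have xa : x = a by apply/eqP; apply: contraNT yA => /(tA x xA); rewrite E.
    by rewrite E xa ga.
(* Only partners of the four vertices of [K] can be fixed by [g]: this is the additive constant
   4. *)
rewrite leq_add2l; apply: leq_trans (card_size [:: f b; f p; f a; f q]).
apply/subset_leq_card/subsetP => x; rewrite inE.
have [|xK] := boolP (x \in K).
  rewrite !inE => /or4P[]/eqP->; rewrite ?gb ?gp ?ga ?gq.
  - by rewrite (neqA b p).
  - by rewrite (neqA b p).
  - by rewrite (neqA a q).
  - by rewrite (neqA a q).
rewrite gE //; case: ifP => [|_]; last by rewrite (negbTE (f_neq x)).
by rewrite !inE => /or4P[]/eqP<- _; rewrite fK eqxx ?orbT.
Qed.

(** The arc grows at either end whose next vertex has its chord into [A]. The chord of [z] is never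
    absorbed, so growth stops at an arc to which [arc_cut] applies. *)
Lemma arc_bound A a b z : arc f s t A a b -> z \notin A -> f z \notin A ->
  n <= 2 * mms G + 4.
Proof.
have [k] := ubnP #|~: A|; elim: k A a b => // k IH A a b ltk arcA zA fzA.
have IHstep w (A' := w |: A) a' b' : w \notin A -> f w \in A -> arc f s t A' a' b' ->
    n <= 2 * mms G + 4.
  move=> wA fwA arcA'; apply: (IH A' a' b') => //; last 2 first.
  - by rewrite !inE negb_or zA andbT; apply: contraNneq fzA => ->.
  - rewrite !inE negb_or fzA andbT; apply: contraNneq zA => wE.
    by rewrite -(fK z) wE.
  rewrite ltnS in ltk; apply: leq_trans ltk; apply: proper_card.
  by rewrite properC; apply/properP; split; [apply: subsetUr|exists w; rewrite ?inE ?eqxx].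
have [fsb|fsb] := boolP (f (s b) \in A).
  apply: (IHstep (s b) a (s b)) => //; first by case: arcA => _ _ [].
  exact: (arc_extend f_neq sK tK s_neq s_closed_full arcA zA fzA).
have [fta|fta] := boolP (f (t a) \in A); last exact: arc_cut arcA fsb fta.
apply: (IHstep (t a) (t a) b) => //; first by case: arcA => _ _ [].
apply: arc_sym; apply: (arc_extend f_neq tK sK t_neq t_closed_full _ zA fzA) => //.
exact: arc_sym.
Qed.

Lemma order_s x : order s x = n.
Proof. by apply: eq_card => y; rewrite inE; apply: s_conn. Qed.

Lemma findex_lt x y : findex s x y < n.
Proof. by rewrite -(order_s x); apply: findex_max. Qed.

Lemma findexK x y : iter (findex s x y) s x = y.
Proof. exact/iter_findex/s_conn. Qed.

Lemma iterK x i : i < n -> findex s x (iter i s x) = i.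
Proof. by move=> lti; rewrite findex_iter // order_s. Qed.

Lemma iter_n x : iter n s x = x.
Proof. by rewrite -(order_s x) iter_order //; apply: can_inj sK. Qed.

(** [findex s y] is the position along the cycle counted from [y]; the chord of [z] lies beyond the
    arc from [y] to [f y], which starts the growth. *)
Lemma noncrossing_bound y z : findex s y (f y) < findex s y z ->
  findex s y (f y) < findex s y (f z) -> n <= 2 * mms G + 4.
Proof.
set j := findex s y (f y) => ltz ltfz.
apply: (@arc_bound [set x | findex s y x <= j] y (f y) z); last 2 first.
- by rewrite inE -ltnNge.
- by rewrite inE -ltnNge.
(* As [z] lies beyond [f y], the successor of [f y] does not wrap round to [y]. *)
have ltj : j.+1 < n by apply: leq_trans (findex_lt y z).
have fyE : f y = iter j s y by rewrite findexK.
split; [split|split|split| |]; rewrite ?inE ?findex0 ?fK ?leqnn //.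
- by rewrite eq_sym f_neq.
- by rewrite findex0.
- by rewrite fyE -iterS iterK // ltnn.
- rewrite -ltnNge ltnNge; apply/negP => le.
  have := findexK y (t y); set i := findex s y (t y) in le *.
  move=> /(congr1 s); rewrite tK -iterS => /(congr1 (findex s y)).
  by rewrite iterK ?findex0 //; lia.
- move=> x; rewrite !inE => le xN; rewrite -(findexK y x) -iterS.
  have ltx : findex s y x < j.
    by rewrite ltn_neqAle le andbT; apply: contraNneq xN => E; rewrite fyE -E findexK.
  by rewrite iterK //; lia.
- move=> x; rewrite !inE => le xN; rewrite -(findexK y x) in le xN *.
  case: (findex s y x) le xN (findex_lt y x) => [|i]; first by rewrite eqxx.
  by rewrite /= sK => le _ lti; rewrite -iterS !iterK // in le *; lia.
Qed.

Lemma findex_shift x m i : m < n -> i < n ->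
  findex s (iter m s x) (iter i s x) = if m <= i then i - m else i + n - m.
Proof.
move=> ltm lti; case: leqP => le.
  by rewrite -{1}(subnK le) iterD iterK //; lia.
have E : iter i s x = iter (i + n - m) s (iter m s x).
  by rewrite -iterD subnK ?iterD ?iter_n //; lia.
by rewrite E iterK //; lia.
Qed.

(** With positions counted from [x], a non-crossing pair is found among the chords at [x], [s x] and
    [v = s (f x)]. *)
Lemma noncommuting_bound x : f (s x) != s (f x) -> n <= 2 * mms G + 4.
Proof.
move=> neq; have fI := inv_inj fK.
pose pos := findex s x; have posI : injective pos.
  by move=> u v E; rewrite -(findexK x u) -(findexK x v) -/(pos u) E.
have pos_lt u : pos u < n := findex_lt x u.
have n_gt : 1 < n.
  have := pos_lt (s x); have := pos_lt x; have : pos x <> pos (s x).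
    by move=> /posI/esym/eqP; rewrite (negbTE (s_neq x)).
  lia.
have pos0 : pos x = 0 by apply: findex0.
have pos1 : pos (s x) = 1 by apply: (@iterK x 1).
have posN u v : u != v -> pos u <> pos v by move=> uv /posI E; rewrite E eqxx in uv.
have shift u v : findex s u v + pos u = if pos u <= pos v then pos v else pos v + n.
  rewrite -{1}(findexK x u) -{1}(findexK x v) findex_shift; try exact: pos_lt.
  by have lu := pos_lt u; rewrite -/(pos u) -/(pos v); case: leqP; lia.
have bound y z : pos y <= pos (f y) -> pos (f y) < pos (f z) ->
    (pos z < pos y) || (pos (f y) < pos z) -> n <= 2 * mms G + 4.
  move=> le1 le2 le3; apply: (@noncrossing_bound y z).
    have := shift y (f y); have := shift y z; rewrite le1.
    by have lf := pos_lt (f y); case: (leqP (pos y) (pos z)); move: le3; lia.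
  by have := shift y (f y); have := shift y (f z); rewrite le1 ifT; lia.
have neqf u v : u != f v -> f u != v by apply: contraNneq => <-; rewrite fK.
have j0 := posN _ _ (f_neq x); have j1 := posN _ _ (fs x).
have k1 := posN _ _ (f_neq (s x)).
have k0 : pos (f (s x)) <> pos x by apply/posN/neqf; rewrite eq_sym.
have kj : pos (f (s x)) <> pos (f x) by apply/posN; rewrite (inj_eq fI) s_neq.
have := pos_lt (f x); have := pos_lt (f (s x)) => ltk ltj.
(* If [f (s x)] precedes [f x], the chord at [s x] is nested under the one at [x]. Otherwise
   [f (s x)] comes even after [v], by [neq]. *)
have [ltkj|ltjk] : pos (f (s x)) < pos (f x) \/ pos (f x) < pos (f (s x)) by lia.
  by apply: (@bound (s x) x); lia.
have posv : pos (s (f x)) = (pos (f x)).+1.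
  by rewrite -{1}(findexK x (f x)) -iterS [pos _]iterK //; rewrite -/(pos (f x)); lia.
set v := s (f x) in posv neq.
have kv := posN _ _ neq.
have m0 : pos (f v) <> pos x by apply/posN/neqf/s_neq.
have m1 : pos (f v) <> pos (s x) by apply/posN/neqf; rewrite eq_sym.
have mv := posN _ _ (f_neq v).
have mj : pos (f v) <> pos (f x).
  by apply/posN; rewrite (inj_eq fI); apply/eqP => vx; move: posv; rewrite vx; lia.
(* Either the chord at [v] lies wholly beyond the chord at [x], or it is nested under the chord at
   [s x]. *)
have [ltm|ltm] : pos v < pos (f v) \/ pos (f v) < pos (f x) by lia.
  by apply: (@bound x v); lia.
by apply: (@bound (f v) (s x)); rewrite ?fK; lia.
Qed.

(* [G] is a Moebius ladder here: the rungs are the pairs [{x, f x}] and two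
   consecutive rungs span a 4-cycle, whose edge cut is a matching. *)
Lemma commuting_bound (y : G) : (forall x, f (s x) = s (f x)) -> 6 < n ->
  n <= 2 * mms G.
Proof.
move=> comm n7; pose pos := findex s y; pose j := pos (f y).
have fyE : f y = iter j s y by rewrite /j /pos findexK.
have fiter i : f (iter i s y) = iter (i + j) s y.
  by elim: i => //= i IH; rewrite comm IH.
have ltj : j < n := findex_lt y (f y).
(* [f] acts as the shift by [j], so [j + j] is a multiple of [n] below [n + n]; it is nonzero since
   [f] fixes no vertex. *)
have nj : n = j + j.
  have E : iter (j + j) s y = y by rewrite -fiter -fyE fK.
  have := f_neq y; case: (ltnP (j + j) n) => lt.
    have := iterK y lt; rewrite E findex0 => j0.
    by rewrite fyE (_ : j = 0) ?eqxx //; lia.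
  move: E; rewrite -(subnK lt) iterD iter_n => /(congr1 pos).
  by rewrite [pos (iter _ _ _)]iterK /pos ?findex0; lia.
pose v i := iter i s y.
have posv i : i < n -> pos (v i) = i by apply: iterK.
have fv i : f (v i) = v (i + j) by apply: fiter.
(* The 4-cycle is spanned by the rungs at [v 1] and [v 2]. The four cycle edges leaving it run from
   [D] to [D']; [6 < n] gives [4 <= j], so their eight ends are distinct. *)
pose D := [:: v 0; v 2; v j; v j.+2]; pose D' := [:: v 1; v 3; v j.+1; v j.+3].
have DD' x : x \in D -> x \in D' = false.
  move=> xD; apply/negP => xD'.
  have : pos x \in [:: 0; 2; j; j.+2].
    by move: xD; rewrite !inE => /or4P[]/eqP->; rewrite posv ?eqxx ?orbT //; lia.
  have : pos x \in [:: 1; 3; j.+1; j.+3].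
    by move: xD'; rewrite !inE => /or4P[]/eqP->; rewrite posv ?eqxx ?orbT //; lia.
  rewrite !inE; lia.
have sD x : x \in D -> s x \in D'.
  by rewrite !inE => /or4P[]/eqP->; rewrite -iterS eqxx ?orbT.
have tD' x : x \in D' -> t x \in D.
  by rewrite !inE => /or4P[]/eqP->; rewrite /= sK eqxx ?orbT.
have fDD x : (x \in D -> f x \in D) * (x \in D' -> f x \in D').
  have vj i : f (v (i + j)) = v i by rewrite -fv fK.
  split; rewrite !inE => /or4P[]/eqP->.
  - by rewrite fv eqxx !orbT.
  - by rewrite fv eqxx !orbT.
  - by rewrite (vj 0) eqxx.
  - by rewrite (vj 2) eqxx orbT.
  - by rewrite fv eqxx !orbT.
  - by rewrite fv eqxx !orbT.
  - by rewrite (vj 1) eqxx.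
  - by rewrite (vj 3) eqxx orbT.
have fD x : (f x \in D) = (x \in D).
  by apply/idP/idP => [/(fDD _).1|/(fDD _).1 //]; rewrite fK.
have fD' x : (f x \in D') = (x \in D').
  by apply/idP/idP => [/(fDD _).2|/(fDD _).2 //]; rewrite fK.
pose g x := if x \in D then s x else if x \in D' then t x else f x.
have D'D x : x \in D' -> x \in D = false.
  by move=> xD'; apply/negP => /DD'; rewrite xD'.
have gK : involutive g.
  move=> x; rewrite {2}/g; case: ifP => xD; last case: ifP => xD'.
  - by rewrite /g (D'D _ (sD x xD)) (sD x xD) sK.
  - by rewrite /g (tD' x xD') tK.
  - by rewrite /g fD fD' xD xD' fK.
have g_adj x : adj x (g x).
  by rewrite /g; case: ifP => _; [apply: s_adj|case: ifP => _; [apply: t_adj|]].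
pose A := [set x in [:: v 1; v 2; v j.+1; v j.+2]].
have v1A : v 1 \in A by rewrite !inE eqxx.
have v0A : v 0 \notin A.
  rewrite !inE; apply/negP => /or4P[]/eqP/(congr1 pos); rewrite !posv; lia.
have := leq_mms cG gK (fun x _ => g_adj x) v1A v0A; rewrite (_ : [set x | _] = set0).
  rewrite cards0 addn0; apply=> x y'.
  have vjj i : f (v (i + j)) = v i by rewrite -fv fK.
  rewrite nbr !in_set => xA yA; rewrite ![y' \in _]inE => /or3P[]/eqP E.
  - move: yA; rewrite E; move: xA; rewrite !inE => /or4P[]/eqP->;
    by rewrite ?(vjj 1) ?(vjj 2) ?fv ?eqxx ?orbT.
  - suff xD : x \in D by rewrite /g xD.
    move: yA; rewrite E; move: xA; rewrite !inE => /or4P[]/eqP->;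
    by rewrite -?iterS ?eqxx ?orbT.
  - suff xD' : x \in D' by rewrite /g (D'D x xD') xD'.
    move: yA; rewrite E; move: xA; rewrite !inE => /or4P[]/eqP->;
    by rewrite /= ?sK ?eqxx ?orbT.
by apply/setP => x; rewrite !inE; apply: contraTF (g_adj x) => /eqP->; rewrite adj_irrefl.
Qed.

End Hamiltonian.

(** * Assembling the cases *)

Lemma mms_bound (G : sgraph) : cubic G -> edge_connected 2 G -> decomposable G ->
  #|G| <= 2 * mms G + 4.
Proof.
move=> G3 G2 dG; have cG := edge_connectedW G2.
have [f [fK f_adj]] := petersen G3 G2.
have [x0 _] : exists x0 : G, x0 \in G by apply/card_gt0P; case: G2 => /ltnW.
pose e := [rel x y : G | adj x y && (y != f x)].
have e_sym : symmetric e.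
  move=> x y; rewrite /= adj_sym; congr (_ && ~~ _).
  by rewrite -(inj_eq (inv_inj fK)) fK eq_sym.
have e_irr : irreflexive e by move=> x; rewrite /= adj_irrefl.
have e2 x : #|[set y | e x y]| = 2.
  have := G3 x; rewrite (cardsD1 (f x)) inE f_adj => -[<-].
  by apply: eq_card => y; rewrite !inE andbC.
have [/forallP conn|/forallPn[x /forallPn[y xy]]] :=
  boolP [forall x, forall y, connect e x y]; last first.
  have f_adj' x1 : f x1 != x1 -> adj x1 (f x1) by [].
  (* Every edge leaving a component of [G - f] is an edge of [f], and [f] has no fixed points. *)
  have xA : x \in [set z | connect e x z] by rewrite inE connect0.
  have yA : y \notin [set z | connect e x z] by rewrite inE.
  apply: leq_trans (leq_mms cG fK f_adj' xA yA _) _.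
    move=> u v; rewrite !inE => xu xv uv; apply/eqP; apply: contraNT xv => vfu.
    by apply: connect_trans xu _; apply: connect1; rewrite /= uv.
  rewrite leq_add2l (_ : [set _ | _] = set0) ?cards0 //.
  by apply/setP => z; rewrite !inE; apply: contraTF (f_adj z) => /eqP->; rewrite adj_irrefl.
have [|s [t [sK tK sconn eE]]] := two_regular_hamiltonian e_sym e_irr e2 x0.
  by move=> x y; apply/forallP.
have nbr x y : adj x y = (y \in [:: f x; s x; t x]).
  have := eE x y; rewrite /= !inE; have [->|] := eqVneq y (f x); first by rewrite f_adj.
  by rewrite andbT.
have fs x : f x != s x.
  by have := eE x (s x); rewrite /= !inE eqxx eq_sym => /andP[].
have [/forallP comm|/forallPn[x]] := boolP [forall x, f (s x) == s (f x)]; last first.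
  exact: (noncommuting_bound cG fK f_adj sK tK sconn nbr fs).
have [le6|gt6] := leqP #|G| 6.
  by apply: leq_trans le6 _; have := mms_gt0 dG; lia.
apply: leq_trans (leq_addr _ _).
by apply: (commuting_bound cG fK f_adj sK tK sconn nbr x0) => // x; apply/eqP.
Qed.

Local Open Scope ring_scope.

Theorem theorem4 (G : sgraph) (n : nat) (hn : #|G| = n)
    (hcubic : cubic G) (hconn : edge_connected 2 G)
    (hdec : decomposable G) :
  n%:R / 2%:R - 2%:R <= (mms G)%:R :> rat.
Proof.
(* The natural-number bound is doubled, so it involves neither division nor truncated
   subtraction. *)
have := mms_bound hcubic hconn hdec; rewrite hn.
rewrite -(Num.Theory.ler_nat rat) GRing.natrD GRing.natrM => le; lra.
Qed.
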